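(* Let $n,d,c\ge 1$ and $t\ge 0$ be integers. Then the set $G(I_{c,(n,d,t)})$ is sortable; that is, if $u,v\in G(I_{c,(n,d,t)})$ and $(u',v')=\operatorname{sort}(u,v)$, then $u',v'\in G(I_{c,(n,d,t)})$.
   Context: $K$ is a field and $S=K[x_1,\dots,x_n]$. A multiset $A=\{i_1\le i_2\le\cdots\le i_d\}$ with elements in $[n]=\{1,\dots,n\}$ is $t$-spread if $i_{k+1}-i_k\ge t$ for all $k$. For a $t$-spread multiset $A$, a block of size $r$ of $A$ is a sub-multiset of consecutive elements $B=\{i_k\le i_{k+1}\le\cdots\le i_{k+r-1}\}$ with $i_{l+1}-i_l=t$ for all consecutive elements of $B$; $|B|=r$ denotes its size (counted with multiplicity). $\mathcal A_{c,(n,d,t)}$ is the set of all $t$-spread multisets $A$ in $[n]$ with $d$ elements (counted with multiplicity) such that $|B|\le c$ for every block $B\subset A$. For a multiset $A=\{i_1\le\cdots\le i_d\}$ put $\mathbf x_A=x_{i_1}\cdots x_{i_d}$. The $c$-bounded $t$-spread Veronese ideal is $I_{c,(n,d,t)}=(\mathbf x_A : A\in\mathcal A_{c,(n,d,t)})\subset S$. For a monomial ideal $I$, $G(I)$ denotes its set of minimal monomial generators. Sorting operator: for monomials $u,v$ of degree $d$ write $uv=x_{i_1}x_{i_2}\cdots x_{i_{2d}}$ with $i_1\le i_2\le\cdots\le i_{2d}$; then $\operatorname{sort}(u,v)=(u',v')$ with $u'=x_{i_1}x_{i_3}\cdots x_{i_{2d-1}}$ and $v'=x_{i_2}x_{i_4}\cdots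 x_{i_{2d}}$. *)

(* Defs.v *)
From mathcomp Require Import all_boot all_order all_algebra.
From mathcomp Require Import mpoly.
From Stdlib Require Classical_Prop.

Set Implicit Arguments.
Unset Strict Implicit.
Unset Printing Implicit Defensive.

Import GRing.Theory.
Local Open Scope ring_scope.

(* The paper's index set [n] = {1, ..., n} is 'I_n (shifted by one), the
   polynomial ring S = K[x_1, ..., x_n] is {mpoly K[n]}, and a monomial of S is
   identified with its exponent vector m : 'X_{1..n}, so that 'X_[m] is the
   monomial as an element of S. *)

Section Multisets.
Variable n : nat.
Implicit Types (A B : seq 'I_n) (t c d : nat).

(* A multiset {i_1 <= ... <= i_d} is given by its nondecreasing listing. *)
Definition is_multiset A : bool := sorted (fun i j : 'I_n => (i <= j)%N) A.

Definition tspread t A : bool := sorted (fun i j : 'I_n => (i + t <= j)%N) A.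

(* [infix B A]: B is a run of consecutive entries of A. *)
Definition is_block t A B : bool :=
  infix B A && sorted (fun i j : 'I_n => j == (i + t)%N :> nat) B.

Definition bounded_spread c d t A : Prop :=
  [/\ is_multiset A, size A = d, tspread t A &
      forall B, is_block t A B -> (size B <= c)%N].

Definition mon_of A : 'X_{1..n} := (\sum_(i <- A) U_(i))%MM.

(* The nondecreasing listing i_1 <= ... <= i_d with m = x_(i_1) ... x_(i_d). *)
Definition vars_of (m : 'X_{1..n}) : seq 'I_n :=
  flatten [seq nseq (m i) i | i <- enum 'I_n].

Lemma vars_of_multiset m : is_multiset (vars_of m).
Proof.
rewrite /is_multiset /vars_of.
have leT : transitive (fun i j : 'I_n => (i <= j)%N).
  by move=> j i k; apply: leq_trans.
have : sorted (fun i j : 'I_n => (i <= j)%N) (enum 'I_n).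
  have := iota_sorted 0 n.
  by rewrite -val_enum_ord sorted_map.
elim: (enum 'I_n) => //= i s IHs.
rewrite !sorted_pairwise // path_sortedE //= => /andP[le_is sorted_s].
rewrite pairwise_cat -!sorted_pairwise // IHs // andbT; apply/andP; split.
  apply/allrelP => x y /nseqP[-> _] /flatten_mapP[j /(allP le_is) le_ij].
  by move=> /nseqP[->].
by elim: (m i) => //= k IHk; case: k IHk => //= k ->; rewrite leqnn.
Qed.

Lemma vars_ofK m : mon_of (vars_of m) = m.
Proof.
rewrite /mon_of /vars_of big_flatten big_map big_enum /=.
rewrite [RHS]multinomUE_id; apply: eq_bigr => i _.
by rewrite big_nseq; elim: (m i) => //= k ->; rewrite mulmS.
Qed.

End Multisets.

Section Ideals.
Variables (K : fieldType) (n : nat).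
Implicit Types (I : {mpoly K[n]} -> Prop) (M : 'X_{1..n} -> Prop).

Definition ideal_gen (P : {mpoly K[n]} -> Prop) (f : {mpoly K[n]}) : Prop :=
  exists s : seq ({mpoly K[n]} * {mpoly K[n]}),
    (forall x, x \in s -> P x.2) /\ f = \sum_(x <- s) x.1 * x.2.

Definition monomial_ideal M : {mpoly K[n]} -> Prop :=
  ideal_gen (fun f => exists2 m, M m & f = 'X_[m]).

(* G(I): the monomials of I that are minimal for divisibility, which is the
   pointwise order (_ <= _)%MM on exponents; [min_gens_generate] and
   [min_gens_least] show that, for a monomial ideal I, this is the least set of
   monomials generating I. *)
Definition min_gens I (m : 'X_{1..n}) : Prop :=
  I 'X_[m] /\
  forall m' : 'X_{1..n}, I 'X_[m'] -> (m' <= m)%MM -> m' = m.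

Definition veronese_ideal (c d t : nat) : {mpoly K[n]} -> Prop :=
  monomial_ideal (fun m => exists2 A, bounded_spread c d t A & m = mon_of A).

Lemma monomial_idealP M m :
  monomial_ideal M 'X_[m] <-> (exists2 m', M m' & (m' <= m)%MM).
Proof.
split=> [[s [Ps def_m]] | [m' Mm' le_m'm]]; last first.
  exists [:: ('X_[m - m'], 'X_[m'])]; split.
    by move=> x; rewrite inE => /eqP-> /=; exists m'.
  by rewrite big_seq1 /= -mpolyXD submK.
have : m \in msupp (\sum_(x <- s) x.1 * x.2) by rewrite -def_m msuppX inE.
elim: s Ps {def_m} => [|x s IHs] Ps; first by rewrite big_nil msupp0.
rewrite big_cons => /msuppD_le; rewrite mem_cat => /orP[|]; last first.
  by apply: IHs => y sy; apply: Ps; rewrite inE sy orbT.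
have [m' Mm' ->] := Ps x (mem_head _ _).
rewrite (perm_mem (msuppMX _ _)) => /mapP[k _ ->].
by exists m' => //; apply: lem_addr.
Qed.

Lemma monomial_ideal_mulX M (g : {mpoly K[n]}) m f :
  (exists2 m', M m' & (m' <= m)%MM) -> monomial_ideal M f ->
  monomial_ideal M (g * 'X_[m] + f).
Proof.
case=> m' Mm' le_m'm [s [Ps ->]].
exists ((g * 'X_[m - m'], 'X_[m']) :: s); split.
  by move=> x; rewrite inE => /orP[/eqP-> | /Ps //]; exists m'.
by rewrite big_cons /= -mulrA -mpolyXD submK.
Qed.

Lemma min_gens_generate M f :
  monomial_ideal (min_gens (monomial_ideal M)) f <-> monomial_ideal M f.
Proof.
have sub (M1 M2 : 'X_{1..n} -> Prop) :
    (forall m, M1 m -> exists2 m', M2 m' & (m' <= m)%MM) ->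
    monomial_ideal M1 f -> monomial_ideal M2 f.
  move=> sub12 [s [Ps ->]]; elim: s Ps => [|x s IHs] Ps.
    by exists [::]; split.
  have [m M1m def_x] := Ps x (mem_head _ _).
  rewrite big_cons def_x; apply: monomial_ideal_mulX; first exact: sub12.
  by apply: IHs => y sy; apply: Ps; rewrite inE sy orbT.
split; apply: sub => m.
  by case=> /monomial_idealP.
move=> Mm; have: monomial_ideal M 'X_[m].
  by apply/monomial_idealP; exists m => //; apply: lepm_refl.
have [k] := ubnP (mdeg m); elim: k m {Mm} => // k IHk m lt_mk Im.
have [min_m | nmin_m] := Classical_Prop.classic
  (min_gens (monomial_ideal M) m); first by exists m => //; apply: lepm_refl.
have [m' [Im' le_m'm ne_m'm]] :
    exists m', [/\ monomial_ideal M 'X_[m'], (m' <= m)%MM & m' <> m].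
  apply: Classical_Prop.NNPP => no_m'; case: nmin_m; split=> // m' Im' le_m'm.
  by apply: Classical_Prop.NNPP => ne_m'm; case: no_m'; exists m'.
have [|m0 min_m0 le_m0m'] := IHk m' _ Im'.
  rewrite ltnS in lt_mk; apply: leq_trans lt_mk.
  rewrite -[in X in (_ < X)%N](submK le_m'm) mdegD -[X in (X < _)%N]add0n.
  rewrite ltn_add2r lt0n mdeg_eq0; apply/eqP => d0.
  by apply: ne_m'm; rewrite -(submK le_m'm) d0 add0m.
by exists m0 => //; apply: lepm_trans le_m'm.
Qed.

Lemma min_gens_least M M' m :
  (forall f, monomial_ideal M' f <-> monomial_ideal M f) ->
  min_gens (monomial_ideal M) m -> M' m.
Proof.
move=> eqI [/eqI/monomial_idealP[m' M'm' le_m'm] min_m].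
rewrite -(min_m m') //; apply/eqI/monomial_idealP.
by exists m' => //; apply: lepm_refl.
Qed.

End Ideals.

Section Sorting.
Variable n : nat.

(* With 0-based positions, the entries of s at even positions are those the
   paper indexes by 1, 3, 5, ... *)
Definition even_entries (s : seq 'I_n) : seq 'I_n :=
  mask [seq ~~ odd k | k <- iota 0 (size s)] s.
Definition odd_entries (s : seq 'I_n) : seq 'I_n :=
  mask [seq odd k | k <- iota 0 (size s)] s.

(* The product uv of monomials is the sum of their exponent vectors. *)
Definition mon_sort (u v : 'X_{1..n}) : 'X_{1..n} * 'X_{1..n} :=
  let s := vars_of (u + v)%MM in
  (mon_of (even_entries s), mon_of (odd_entries s)).

Definition sortable (G : 'X_{1..n} -> Prop) : Prop :=
  forall u v u' v', G u -> G v -> (u', v') = mon_sort u v -> G u' /\ G v'.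

End Sorting.

(* Main.v *)
Require Import Defs.
From mathcomp Require Import all_boot all_order all_algebra.
From mathcomp Require Import mpoly zify.

(** Write a nondecreasing sequence s as (k, w)-spaced when s_(j+k) - s_j >= w
    for all j.  Both conditions defining the monomials x_A are of this kind:
    being t-spread is being (1, t)-spaced, and for a t-spread A a block of size
    c + 1 is a run i_j <= ... <= i_(j+c) with i_(j+c) - i_j = ct, the least
    value allowed by t-spreadness, so that blocks have size at most c exactly
    when A is (c, ct + 1)-spaced ([bounded_spreadP]).

    Any condition of this kind survives sorting.  A nondecreasing sequence is
    (k, w)-spaced if and only if every window [x, x + w) contains at most k of
    its entries ([count_window_spaced], [spaced_count_window]).  Counts add up,
    so the sorted union of two (k, w)-spaced multisets has at most 2k entries
    in each window, hence is (2k, w)-spaced.  Taking every other entry of a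
    (2k, w)-spaced sequence leaves a (k, w)-spaced one.

    Finally all x_A have the same degree d, so none properly divides another
    and they are the minimal generators of the ideal they generate
    ([min_gens_veroneseP]). *)

(** * Spaced sequences of natural numbers *)

Definition spaced (k w : nat) (s : seq nat) : Prop :=
  forall j, j + k < size s -> nth 0 s j + w <= nth 0 s (j + k).

Definition window (x w : nat) : pred nat := fun y => x <= y < x + w.

(** If the head y of the sequence lies in the window, then the entries from
    position k on are at least y + w, hence beyond the window; if not, the head
    can be dropped. *)
Lemma count_window_spaced k w x s :
  sorted leq s -> spaced k w s -> count (window x w) s <= k.
Proof.
elim: s => // y s IHs sorted_ys spaced_ys.
have [win_y|/negbTE nwin_y] := boolP (window x w y); last first.
  rewrite /= nwin_y; apply: IHs; first exact: path_sorted sorted_ys.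
  by move=> j lt_j; apply: (spaced_ys j.+1); rewrite addSn.
rewrite -(cat_take_drop k (y :: s)) count_cat.
have /eqP-> : count (window x w) (drop k (y :: s)) == 0.
  rewrite -leqn0 leqNgt -has_count; apply/hasPn => z /(nthP 0)[i].
  rewrite size_drop nth_drop => lt_i <-.
  have lt_ki : k + i < size (y :: s) by rewrite -ltn_subRL.
  have le_yk : y + w <= nth 0 (y :: s) k.
    exact: spaced_ys 0 (leq_ltn_trans (leq_addr i k) lt_ki).
  have le_ki : nth 0 (y :: s) k <= nth 0 (y :: s) (k + i).
    apply: (sorted_leq_nth leq_trans leqnn) => //; rewrite ?inE ?leq_addr //.
    by apply: leq_ltn_trans lt_ki; rewrite leq_addr.
  case/andP: win_y => le_xy _; rewrite /window negb_and -leqNgt orbC.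
  by rewrite (leq_trans _ (leq_trans le_yk le_ki)) ?leq_add2r.
rewrite addn0; apply: leq_trans (count_size _ _) _.
by rewrite size_take; case: ltnP.
Qed.

(** A gap s_(j+k) - s_j < w would put the k + 1 entries from s_j to s_(j+k) in
    the window starting at s_j. *)
Lemma spaced_count_window k w s :
  sorted leq s -> (forall x, count (window x w) s <= k) -> spaced k w s.
Proof.
move=> sorted_s le_count j lt_jk; rewrite leqNgt; apply/negP => lt_w.
have := le_count (nth 0 s j); apply/negP; rewrite -ltnNge.
have size_run : size (take k.+1 (drop j s)) = k.+1.
  by rewrite size_take size_drop; case: ltnP => //; lia.
have: all (window (nth 0 s j) w) (take k.+1 (drop j s)).
  apply/(all_nthP 0) => i; rewrite size_run => lt_i.
  rewrite nth_take // nth_drop.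
  have le_nth a b : a <= b -> b < size s -> nth 0 s a <= nth 0 s b.
    move=> le_ab lt_b.
    by apply: (sorted_leq_nth leq_trans leqnn) => //; rewrite inE; lia.
  apply/andP; split; first by apply: le_nth; lia.
  by apply: leq_ltn_trans lt_w; apply: le_nth; lia.
rewrite all_count size_run => /eqP count_run.
rewrite -(cat_take_drop j s) count_cat.
rewrite -[X in _ + count _ X](cat_take_drop k.+1) count_cat cat_take_drop.
by rewrite count_run; lia.
Qed.

(** * Bounded spread multisets as spaced sequences *)

Lemma spaced_tspread n t (A : seq 'I_n) :
  tspread t A <-> spaced 1 t (map val A).
Proof.
have -> : tspread t A = sorted (fun i j => i + t <= j) (map val A).
  by rewrite sorted_map.
split=> [/(sortedP 0) tA j | tA].
  by rewrite addn1 => /tA.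
by apply/(sortedP 0) => j; have := tA j; rewrite addn1.
Qed.

Lemma spaced_tspread_iter t s j i :
  spaced 1 t s -> j + i < size s -> nth 0 s j + i * t <= nth 0 s (j + i).
Proof.
move=> ts; elim: i => [|i IHi] lt_ji; first by rewrite addn0 mul0n addn0.
have := ts (j + i); rewrite -addnA addn1 => /(_ lt_ji).
by have := IHi ltac:(lia); lia.
Qed.

(** In a t-spread sequence i_(j+c) - i_j is a sum of c gaps, each at least t;
    if it is at most ct then all these gaps equal t and the run is a block. *)
Lemma bounded_spreadP n c d t (A : seq 'I_n) :
  bounded_spread c d t A <->
  [/\ sorted leq (map val A), size A = d,
      spaced 1 t (map val A) & spaced c (c * t).+1 (map val A)].
Proof.
have multisetE : is_multiset A = sorted leq (map val A) by rewrite sorted_map.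
have gapsE (B : seq 'I_n) : sorted (fun i j : 'I_n => j == i + t :> nat) B
    = sorted (fun i j => j == i + t) (map val B) by rewrite sorted_map.
split=> [[mA sA /spaced_tspread tA blkA] | [mA sA tA cA]].
  split=> //; first by rewrite -multisetE.
  move=> j lt_jc; rewrite addnS ltnNge; apply/negP => le_jc.
  have sizeA : size (map val A) = size A by rewrite size_map.
  pose B := take c.+1 (drop j A).
  have sizeB : size B = c.+1.
    by rewrite size_take size_drop; case: ltnP => //; lia.
  suff /blkA : is_block t A B by rewrite sizeB ltnn.
  apply/andP; split.
    by apply: infix_trans (prefixW (prefix_take _ _)) (suffixW (suffix_drop _ _)).
  rewrite gapsE; apply/(sortedP 0) => i; rewrite size_map sizeB => lt_ic.
  rewrite !map_take !map_drop !nth_take ?nth_drop; try lia.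
  have h1 := spaced_tspread_iter t _ j i tA ltac:(lia).
  have h2 := tA (j + i) ltac:(lia).
  have h3 := spaced_tspread_iter t _ (j + i.+1) (c - i.+1) tA ltac:(lia).
  move: h1 h2 h3; have -> : j + i.+1 + (c - i.+1) = j + c by lia.
  rewrite -addnA addn1 => h1 h2 h3.
  have eq_ct : c * t = i * t + t + (c - i.+1) * t.
    by rewrite -mulSnr -mulnDl; congr (_ * _); lia.
  by apply/eqP; lia.
split=> //; [by rewrite multisetE | exact/spaced_tspread |].
move=> B /andP[/infixP[A1 [A2 defA]]]; rewrite gapsE => /(sortedP 0) gapB.
rewrite leqNgt; apply/negP => lt_cB; rewrite size_map in gapB.
have nthA i : i < size B -> nth 0 (map val A) (size A1 + i) = nth 0 (map val B) i.
  move=> lt_i; rewrite defA !map_cat nth_cat size_map.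
  by rewrite ltnNge leq_addr /= addKn nth_cat size_map lt_i.
have iterB i : i < size B -> nth 0 (map val B) i = nth 0 (map val B) 0 + i * t.
  elim: i => [|i IHi] lt_i; first by rewrite mul0n addn0.
  by have /eqP-> := gapB i lt_i; rewrite IHi ?(ltnW lt_i) // mulSnr addnA.
have lt_c : size A1 + c < size (map val A).
  by rewrite size_map defA !size_cat ltn_add2l ltn_addr.
have := cA _ lt_c; rewrite nthA // -[X in nth _ _ X + _]addn0.
rewrite nthA ?(leq_ltn_trans _ lt_cB) // (iterB c) //.
by rewrite addnS ltnn.
Qed.

(** * Every other entry of a sequence *)

Section EveryOther.
Variable n : nat.
Implicit Types (x : 'I_n) (s : seq 'I_n).

Lemma even_entries_cons x s : even_entries (x :: s) = x :: odd_entries s.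
Proof.
rewrite /even_entries /odd_entries /= (iotaDl 1 0) -map_comp.
by congr (_ :: mask _ _); apply: eq_map => k /=; rewrite negbK.
Qed.

Lemma odd_entries_cons x s : odd_entries (x :: s) = even_entries s.
Proof.
by rewrite /even_entries /odd_entries /= (iotaDl 1 0) -map_comp.
Qed.

Lemma size_entries s :
  size (even_entries s) = uphalf (size s) /\
  size (odd_entries s) = (size s)./2.
Proof.
elim: s => // x s [IHe IHo].
by rewrite even_entries_cons odd_entries_cons /= IHe IHo.
Qed.

(** There is no bound on j: past the end, both sides are the default 0. *)
Lemma nth_entries s j :
  nth 0 (map val (even_entries s)) j = nth 0 (map val s) j.*2 /\
  nth 0 (map val (odd_entries s)) j = nth 0 (map val s) j.*2.+1.
Proof.
elim: s j => [|x s IHs] j; first by rewrite !nth_nil.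
rewrite even_entries_cons odd_entries_cons /=.
split; last by case: (IHs j).
by case: j => // j; case: (IHs j).
Qed.

Lemma spaced_entries k w s :
  spaced k.*2 w (map val s) ->
  spaced k w (map val (even_entries s)) /\
  spaced k w (map val (odd_entries s)).
Proof.
move=> spaced_s; have [size_e size_o] := size_entries s.
split=> j; rewrite size_map ?size_e ?size_o => lt_jk.
  have [-> _] := nth_entries s j; have [-> _] := nth_entries s (j + k).
  rewrite doubleD; apply: spaced_s.
  by rewrite size_map -doubleD -gtn_uphalf_double.
have [_ ->] := nth_entries s j; have [_ ->] := nth_entries s (j + k).
rewrite doubleD -addSn; apply: spaced_s.
by rewrite size_map addSn -doubleD -gtn_half_double.
Qed.

(** The hypotheses on s are those that the sorted union of two bounded spread
    multisets satisfies: the two conditions of [bounded_spreadP] with the number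
    of entries that a window may contain doubled. *)
Lemma bounded_spread_entries c d t s :
  sorted leq (map val s) -> size s = d.*2 ->
  spaced 2 t (map val s) -> spaced c.*2 (c * t).+1 (map val s) ->
  bounded_spread c d t (even_entries s) /\
  bounded_spread c d t (odd_entries s).
Proof.
move=> sorted_s size_s /(spaced_entries 1)[te to] /spaced_entries[ce co].
have [size_e size_o] := size_entries s.
split; apply/bounded_spreadP; split=> //.
- by rewrite /even_entries map_mask; apply: (sorted_mask leq_trans).
- by rewrite size_e size_s uphalf_double.
- by rewrite /odd_entries map_mask; apply: (sorted_mask leq_trans).
- by rewrite size_o size_s doubleK.
Qed.

End EveryOther.

(** * Monomials and multisets *)

Section Monomials.
Variable n : nat.
Implicit Types s A B : seq 'I_n.

Lemma mon_ofE s i : mon_of s i = count_mem i s.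
Proof.
rewrite /mon_of; elim: s => [|x s IHs]; first by rewrite big_nil mnm0E.
by rewrite big_cons mnmDE mnm1E IHs.
Qed.

Lemma mdeg_mon_of s : mdeg (mon_of s) = size s.
Proof.
rewrite /mon_of; elim: s => [|x s IHs]; first by rewrite big_nil mdeg0.
by rewrite big_cons mdegD mdeg1 IHs.
Qed.

Lemma perm_vars_of_mul A B :
  perm_eq (vars_of (mon_of A + mon_of B)%MM) (A ++ B).
Proof.
apply/allP => i _ /=.
by rewrite -mon_ofE vars_ofK mnmDE !mon_ofE count_cat.
Qed.

(** Window counts ignore the order of the entries, so the listing of a product
    may be replaced by the concatenation of the listings of its factors. *)
Lemma spaced_mul k w A B :
  sorted leq (map val A) -> sorted leq (map val B) ->
  spaced k w (map val A) -> spaced k w (map val B) ->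
  spaced k.*2 w (map val (vars_of (mon_of A + mon_of B)%MM)).
Proof.
move=> mA mB sA sB; apply: spaced_count_window => [|x].
  by rewrite sorted_map; apply: vars_of_multiset.
have /permP-> := perm_map val (perm_vars_of_mul A B).
by rewrite map_cat count_cat -addnn leq_add // count_window_spaced.
Qed.

Lemma lepm_mdeg_eq (m1 m2 : 'X_{1..n}) :
  (m1 <= m2)%MM -> mdeg m1 = mdeg m2 -> m1 = m2.
Proof.
move=> le12 eq_deg; rewrite -(submK le12).
have : mdeg (m2 - m1)%MM == 0.
  by move: eq_deg; rewrite -{1}(submK le12) mdegD; lia.
by rewrite mdeg_eq0 => /eqP->; rewrite add0m.
Qed.

Lemma min_gens_veroneseP (K : fieldType) c d t (m : 'X_{1..n}) :
  min_gens (veronese_ideal (K := K) c d t) m <->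
  (exists2 A, bounded_spread c d t A & m = mon_of A).
Proof.
rewrite /veronese_ideal; split.
  case=> /monomial_idealP[m' [A bA def_m'] le_m'm] min_m.
  exists A => //; rewrite -def_m'; apply/esym/min_m => //.
  by apply/monomial_idealP; exists m'; [exists A | apply: lepm_refl].
case=> A bA def_m; split.
  by apply/monomial_idealP; exists m; [exists A | apply: lepm_refl].
move=> m1 /monomial_idealP[m2 [A2 bA2 def_m2] le21] le1m.
have eq2m : m2 = m.
  apply: lepm_mdeg_eq; first exact: lepm_trans le1m.
  by rewrite def_m def_m2 !mdeg_mon_of; case: bA bA2 => _ -> _ _ [].
apply/mnmP => i; apply/eqP; rewrite eqn_leq (mnm_lepP le1m) /= -eq2m.
exact: mnm_lepP le21 i.
Qed.

End Monomials.

(** * Sortability *)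

Theorem theorem3p1 (K : fieldType) (n d c t : nat)
    (hn : (1 <= n)%N) (hd : (1 <= d)%N) (hc : (1 <= c)%N) :
  sortable (min_gens (veronese_ideal (K := K) (n := n) c d t)).
Proof.
move=> u v u' v' /min_gens_veroneseP[A /bounded_spreadP[mA sA tA cA] ->].
move=> /min_gens_veroneseP[B /bounded_spreadP[mB sB tB cB] ->].
rewrite /mon_sort; set s := vars_of _ => -[-> ->].
have [||||bound_e bound_o] := @bounded_spread_entries n c d t s.
- by rewrite sorted_map; apply: vars_of_multiset.
- by rewrite (perm_size (perm_vars_of_mul _ A B)) size_cat sA sB addnn.
- exact: (spaced_mul _ 1).
- exact: spaced_mul.
split; apply/min_gens_veroneseP.
  by exists (even_entries s).
by exists (odd_entries s).
Qed.
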